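(* Let $k,\ell$ be coprime integers with $k>\ell>1$, let $A(z),B(z)\in\mathbb{C}[z]$ be non-zero polynomials with $\deg(A(z)B(z))\geqslant 1$, and let $\{P_n(z)\}_{n\geqslant 0}$ be the polynomial sequence defined by $$P_n(z)+B(z)P_{n-\ell}(z)+A(z)P_{n-k}(z)=0\quad (n\geqslant 1),\qquad P_0(z)=1,\quad P_{-1}(z)=\cdots=P_{1-k}(z)=0.$$ Let $z_0\in\mathcal{Z}_{\{P_n(z)\}}-\mathcal{Z}_{A(z)}$, i.e. $z_0$ is a zero of some polynomial $P_n(z)$ that is not identically zero, and $A(z_0)\neq 0$. Then $z_0$ lies on the curve $$\Gamma_1:=\begin{cases}\left\{z\in\Gamma: \mathrm{Re}\left((-1)^{k-\ell}\frac{B^k(z)}{A^{\ell}(z)}\right)\leqslant 0\right\}, & \text{if }\mathcal{Z}_{B(z)}-\mathcal{Z}_{A(z)}\neq\emptyset,\\[2mm] \left\{z\in\Gamma:\mathrm{Re}\left((-1)^{k-\ell}\frac{B^k(z)}{A^{\ell}(z)}\right)<0\right\}, & \text{if }\mathcal{Z}_{B(z)}\subset\mathcal{Z}_{A(z)},\end{cases}$$ where $\Gamma:=\left\{z\in\mathbb{C}:\mathrm{Im}\left((-1)^k\frac{B^k(z)}{A^{\ell}(z)}\right)=0\right\}$.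
   Context: For a non-zero polynomial $f$, $\mathcal{Z}_{f(z)}$ is the set of complex zeros of $f$; for a non-empty set $\mathcal{X}$ of non-zero complex polynomials, $\mathcal{Z}_{\mathcal{X}}=\bigcup_{f\in\mathcal{X}}\mathcal{Z}_{f(z)}$. $\mathcal{Z}_{\{P_n(z)\}}$ is the union of the zero sets of those $P_n(z)$ that are not identically zero. The quotient $B^k(z)/A^\ell(z)$ is considered at points where $A(z)\neq 0$; $B^k(z)=(B(z))^k$, $A^\ell(z)=(A(z))^\ell$. *)

(* Defs.v *)
From HB Require Import structures.
From mathcomp Require Import all_boot all_order all_algebra.
From mathcomp Require Import boolp classical_sets reals complex.

Set Implicit Arguments.
Unset Strict Implicit.
Unset Printing Implicit Defensive.

Import Order.TTheory GRing.Theory Num.Theory.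

Local Open Scope classical_set_scope.
Local Open Scope ring_scope.
Local Open Scope complex_scope.

Definition zeros (R : realType) (f : {poly R[i]}) : set R[i] :=
  [set z | root f z].

Definition family_zeros (R : realType) (X : set {poly R[i]}) : set R[i] :=
  \bigcup_(f in X) zeros f.

(* The members P_n, n >= 0, that are not identically zero; the recurrence also
   uses negative indices, which do not belong to the sequence itself. *)
Definition nonzero_terms (R : realType) (P : int -> {poly R[i]}) :
    set {poly R[i]} :=
  [set f | f != 0 /\ exists n : nat, f = P n%:Z].

(* Only the values of P at indices n > - k are constrained. *)
Definition is_recurrence_seq (R : realType) (k l : nat) (A B : {poly R[i]})
    (P : int -> {poly R[i]}) : Prop :=
  [/\ forall n : int, 1 <= n -> P n + B * P (n - l%:Z) + A * P (n - k%:Z) = 0,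
      P 0 = 1
    & forall n : int, 1 - k%:Z <= n <= - 1 -> P n = 0].

Definition quot_pow (R : realType) (k l : nat) (A B : {poly R[i]})
    (z : R[i]) : R[i] :=
  B.[z] ^+ k / A.[z] ^+ l.

(* Since x / 0 = 0 here, the zeros of A, where the quotient is undefined, have
   to be excluded explicitly. *)
Definition Gamma (R : realType) (k l : nat) (A B : {poly R[i]}) : set R[i] :=
  [set z | A.[z] != 0 /\ complex.Im ((-1) ^+ k * quot_pow k l A B z) = 0].

Definition Gamma1 (R : realType) (k l : nat) (A B : {poly R[i]}) : set R[i] :=
  if `[< zeros B `\` zeros A !=set0 >] then
    [set z | Gamma k l A B z /\
       complex.Re ((-1) ^+ (k - l) * quot_pow k l A B z) <= 0]
  else (* zeros B `<=` zeros A *)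
    [set z | Gamma k l A B z /\
       complex.Re ((-1) ^+ (k - l) * quot_pow k l A B z) < 0].

(* Main.v *)
(** At a fixed point z with A(z), B(z) nonzero, put a = -A(z), b = -B(z),
    p_n = P_n(z) and q(i,j) = p_(li+kj) / (b^i a^j) on the lattice Z x Z. The
    recurrence becomes Pascal's rule q(i,j) = q(i-1,j) + q(i,j-1), and q is
    quasi-periodic: q(i-k,j+l) = x q(i,j) with x = b^k / a^l. If x is not real,
    the complex numbers q(i,j) with li+kj in a window of k consecutive integers,
    extended by quasi-periodicity, stay ordered by argument as the window moves,
    because each step replaces an entry by its sum with its neighbour. If x > 0,
    they stay nonnegative. In both cases the two summands can cancel only when
    both vanish, so p_n = 0 forces P_n = 0. Hence x < 0 at a zero of a nonzero
    P_n. *)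
Require Import Defs.
From HB Require Import structures.
From mathcomp Require Import all_boot all_order all_algebra.
From mathcomp Require Import boolp classical_sets reals complex.
From mathcomp Require Import zify ring lra.

Set Implicit Arguments.
Unset Strict Implicit.
Unset Printing Implicit Defensive.

Import Order.TTheory GRing.Theory Num.Theory.

Local Open Scope classical_set_scope.
Local Open Scope ring_scope.
Local Open Scope complex_scope.

(** * Lattice points and Pascal's rule *)

(** By coprimality, [k] divides [i - i'] as soon as it divides [l * (i - i')]; so each fibre of
    [l i + k j] is one orbit of the translation by [(- k, l)]. *)
Lemma lattice_fiber (k l : nat) (i j i' j' : int) : coprime k l -> (0 < k)%N ->
    l%:Z * i + k%:Z * j = l%:Z * i' + k%:Z * j' ->
  exists s : int, i' = i - k%:Z * s /\ j' = j + l%:Z * s.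
Proof.
move=> coprime_kl k_gt0 eq_n.
have : (k %| l%:Z * (i - i'))%Z.
  by apply/dvdzP; exists (j' - j); lia.
rewrite Gauss_dvdzr // => /dvdzP[s def_s]; exists s.
by split; nia.
Qed.

Lemma lattice_exists (k l : nat) (n : int) : coprime k l ->
  exists i j : int, n = l%:Z * i + k%:Z * j.
Proof.
move=> coprime_kl; have [u [v uv]] := Bezoutz l k.
exists (n * u), (n * v).
have g1 : gcdz l k = 1 by apply/eqP; rewrite -/(coprimez _ _) coprimez_sym.
by rewrite g1 in uv; rewrite -[LHS]mulr1 -uv; ring.
Qed.

Definition lattice_val (F : fieldType) (k l : nat) (a b : F) (p : int -> F)
    (i j : int) : F :=
  p (l%:Z * i + k%:Z * j) / (b ^ i * a ^ j).

Section Lattice.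
Variables (F : fieldType) (k l : nat) (a b : F) (p : int -> F).
Hypotheses (a_neq0 : a != 0) (b_neq0 : b != 0).
Hypothesis p_rec :
  forall n : int, 1 <= n -> p n = b * p (n - l%:Z) + a * p (n - k%:Z).

Local Notation q := (lattice_val k l a b p).

Lemma lattice_val_eq0 (i j : int) :
  (q i j == 0) = (p (l%:Z * i + k%:Z * j) == 0).
Proof.
rewrite mulf_eq0 invr_eq0 mulf_eq0 !expfz_eq0.
by rewrite (negPf a_neq0) (negPf b_neq0) !andbF !orbF.
Qed.

Lemma lattice_val_rec (i j : int) : 1 <= l%:Z * i + k%:Z * j ->
  q i j = q (i - 1) j + q i (j - 1).
Proof.
move=> n_ge1; rewrite /lattice_val (p_rec n_ge1).
have -> : l%:Z * (i - 1) + k%:Z * j = l%:Z * i + k%:Z * j - l%:Z by ring.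
have -> : l%:Z * i + k%:Z * (j - 1) = l%:Z * i + k%:Z * j - k%:Z by ring.
rewrite !expfzDr // !exprN1.
move: (expfz_neq0 i b_neq0) (expfz_neq0 j a_neq0).
move: (b ^ i) (a ^ j) (p (_ - l%:Z)) (p (_ - k%:Z)) => bi aj u v bi0 aj0.
by field; rewrite a_neq0 b_neq0 bi0 aj0.
Qed.

(** The translation fixes the index [l i + k j]; only the denominator changes, by the factor
    [(a ^ l / b ^ k) ^ s]. *)
Lemma lattice_val_shift (i j s : int) :
  q (i - k%:Z * s) (j + l%:Z * s) = (b ^+ k / a ^+ l) ^ s * q i j.
Proof.
rewrite /lattice_val.
have -> : l%:Z * (i - k%:Z * s) + k%:Z * (j + l%:Z * s) =
  l%:Z * i + k%:Z * j by ring.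
rewrite !expfzDr // -mulrN -!exprz_exp -!exprnP expfzMl exprz_inv -!invr_expz.
have bk_neq0 : b ^+ k != 0 by rewrite expf_neq0.
have al_neq0 : a ^+ l != 0 by rewrite expf_neq0.
move: (expfz_neq0 i b_neq0) (expfz_neq0 j a_neq0).
move: (expfz_neq0 s bk_neq0) (expfz_neq0 s al_neq0).
move: (b ^ i) (a ^ j) ((b ^+ k) ^ s) ((a ^+ l) ^ s) (p _) => bi aj bk al u.
by move=> bk0 al0 bi0 aj0; field; rewrite bk0 al0 bi0 aj0.
Qed.

End Lattice.

(** * Orientation of pairs of complex numbers *)

Section Cross.
Variable R : rcfType.
Implicit Types x u v w : R[i].

(** This is the imaginary part of the conjugate of [u] times [v]: positive when [v] lies
    counterclockwise from [u] by less than half a turn. *)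
Definition cross u v : R :=
  complex.Re u * complex.Im v - complex.Im u * complex.Re v.

Lemma crossDl u v w : cross (u + v) w = cross u w + cross v w.
Proof. by case: u v w => [? ?] [? ?] [? ?]; rewrite /cross /=; ring. Qed.

Lemma crossDr u v w : cross w (u + v) = cross w u + cross w v.
Proof. by case: u v w => [? ?] [? ?] [? ?]; rewrite /cross /=; ring. Qed.

Lemma cross0l v : cross 0 v = 0.
Proof. by rewrite /cross /= !mul0r subr0. Qed.

Lemma cross0r v : cross v 0 = 0.
Proof. by rewrite /cross /= !mulr0 subr0. Qed.

Lemma crossvv v : cross v v = 0.
Proof. by rewrite /cross mulrC subrr. Qed.

Lemma crossNl u v : cross (- u) v = - cross u v.
Proof. by case: u v => [? ?] [? ?]; rewrite /cross /=; ring. Qed.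

Lemma cross_mulr x u :
  cross u (x * u) = complex.Im x * (complex.Re u ^+ 2 + complex.Im u ^+ 2).
Proof. by case: u x => [? ?] [? ?]; rewrite /cross /=; ring. Qed.

(** With [v = - u], the quantity assumed nonnegative is [- (Im x) ^ 2 * |u| ^ 2], which forces
    [u = 0]. *)
Lemma sector_add_eq0 x u v : complex.Im x != 0 ->
  0 <= complex.Im x * cross v (x * u) -> u + v = 0 -> u = 0 /\ v = 0.
Proof.
move=> x_neq0 + /eqP; rewrite addrC addr_eq0 => + /eqP v_def.
rewrite v_def crossNl cross_mulr mulrN mulrA oppr_ge0 -expr2 => le0.
have x2_gt0 : 0 < complex.Im x ^+ 2 by rewrite exprn_even_gt0.
have : complex.Re u ^+ 2 + complex.Im u ^+ 2 <= 0.
  by rewrite -(pmulr_rle0 _ x2_gt0).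
case: u {v_def le0} => [c d] /= le0.
have : c ^+ 2 + d ^+ 2 == 0 by rewrite eq_le le0 addr_ge0 ?sqr_ge0.
rewrite paddr_eq0 ?sqr_ge0 // !sqrf_eq0 => /andP[/eqP-> /eqP->].
by rewrite oppr0.
Qed.

End Cross.

(** * Propagation of zeros at a fixed point *)

Section NonVanishing.
Variables (R : rcfType) (k l : nat) (a b : R[i]) (p : int -> R[i]).
Hypotheses (coprime_kl : coprime k l) (l_gt0 : (0 < l)%N) (l_lt_k : (l < k)%N).
Hypotheses (a_neq0 : a != 0) (b_neq0 : b != 0).
Hypothesis p_rec :
  forall n : int, 1 <= n -> p n = b * p (n - l%:Z) + a * p (n - k%:Z).
Hypothesis p_0 : p 0 = 1.
Hypothesis p_neg : forall n : int, 1 - k%:Z <= n <= - 1 -> p n = 0.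

Local Notation q := (lattice_val k l a b p).
Local Notation x := (b ^+ k / a ^+ l).

Let k_gt0 : (0 < k)%N. Proof. exact: leq_trans l_lt_k. Qed.

Lemma lattice_val_neg (i j : int) :
  1 - k%:Z <= l%:Z * i + k%:Z * j <= - 1 -> q i j = 0.
Proof. by move=> /p_neg n_neg; apply/eqP; rewrite lattice_val_eq0 // n_neg. Qed.

Lemma lattice_val_origin (i j : int) : l%:Z * i + k%:Z * j = 0 ->
  exists s : int, q i j = x ^ s.
Proof.
move=> n0; have [|s [-> ->]] := @lattice_fiber k l 0 0 i j coprime_kl k_gt0.
  by rewrite n0 !mulr0.
exists s; rewrite lattice_val_shift // /lattice_val !mulr0 addr0 p_0.
by rewrite !expr0z mulr1 invr1 !mulr1.
Qed.

(* The window makes i and i' incongruent mod k unless the indices agree, so for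
   the newest entry the bounds on i - i' are strict and leave room for the shift
   by 1 in Pascal's rule. *)
Lemma lattice_cross_ge0 (N : nat) (i j i' j' : int) :
    N%:Z - k%:Z < l%:Z * i + k%:Z * j <= N%:Z ->
    N%:Z - k%:Z < l%:Z * i' + k%:Z * j' <= N%:Z ->
    i' <= i <= i' + k%:Z ->
  0 <= complex.Im x * cross (q i j) (q i' j').
Proof.
have same_n (u v u' v' : int) : l%:Z * u + k%:Z * v = l%:Z * u' + k%:Z * v' ->
    u' <= u <= u' + k%:Z -> 0 <= complex.Im x * cross (q u v) (q u' v').
  move=> /(lattice_fiber coprime_kl k_gt0)[s [-> ->]] u_le.
  (* The first coordinates differ by [k * s], so the bounds leave the same point or one period;
     there the cross product is [Im x * |q u v| ^ 2]. *)
  have [->|->] : s = 0 \/ s = 1 by nia.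
    by rewrite !mulr0 subr0 addr0 crossvv mulr0.
  rewrite lattice_val_shift // expr1z cross_mulr mulrA -expr2.
  by rewrite mulr_ge0 ?addr_ge0 ?sqr_ge0.
have no_mult (t : int) : k%:Z * t != 0 -> - k%:Z < k%:Z * t < k%:Z -> False.
  have [t_lt0|t_gt0|->] := ltgtP t 0 => [kt0 kt|kt0 kt|]; last by rewrite mulr0.
  - have : k%:Z * t <= k%:Z * - 1 by apply: ler_wpM2l; lia.
    by lia.
  - have : k%:Z * 1 <= k%:Z * t by apply: ler_wpM2l; lia.
    by lia.
elim: N i j i' j' => [|N IHN] i j i' j' n_win n'_win i_le.
  have [nn'|nn'] := eqVneq (l%:Z * i + k%:Z * j) (l%:Z * i' + k%:Z * j').
    exact: same_n.
  (* In the initial window only index [0] carries a nonzero value, so one of two distinct indices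
     gives [0]. *)
  have [n0|n0] := eqVneq (l%:Z * i + k%:Z * j) 0.
    by rewrite (@lattice_val_neg i' j') ?cross0r ?mulr0; last lia.
  by rewrite (@lattice_val_neg i j) ?cross0l ?mulr0; last lia.
have [nn'|nn'] := eqVneq (l%:Z * i + k%:Z * j) (l%:Z * i' + k%:Z * j').
  exact: same_n.
have i_neq : i != i'.
  by apply/eqP => ii'; subst i'; apply: (no_mult (j - j')); lia.
have i_neqk : i != i' + k%:Z.
  by apply/eqP => ii'; subst i; apply: (no_mult (l%:Z + j - j')); lia.
(* Both predecessors [N + 1 - l] and [N + 1 - k] of the newest index lie in the previous window, the
   latter at its lower end. *)
have [nN|n_neq] := eqVneq (l%:Z * i + k%:Z * j) N.+1%:Z.
  rewrite (@lattice_val_rec _ k l a b p _ _ _ i j) //; last by lia.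
  rewrite crossDl mulrDr addr_ge0 // IHN //; lia.
have [n'N|n'_neq] := eqVneq (l%:Z * i' + k%:Z * j') N.+1%:Z.
  rewrite (@lattice_val_rec _ k l a b p _ _ _ i' j') //; last by lia.
  rewrite crossDr mulrDr addr_ge0 // IHN //; lia.
apply: IHN; lia.
Qed.

(** The initial values are zeros and powers of [x], and Pascal's rule preserves nonnegativity. *)
Lemma lattice_val_ge0 (i j : int) : 0 < x ->
  1 - k%:Z <= l%:Z * i + k%:Z * j -> 0 <= q i j.
Proof.
move=> x_gt0.
have [N] : exists N : nat, l%:Z * i + k%:Z * j <= N%:Z.
  by exists (absz (l%:Z * i + k%:Z * j)); lia.
elim: N i j => [|N IHN] i j n_le n_ge.
  have [/lattice_val_origin[s ->]|n0] := eqVneq (l%:Z * i + k%:Z * j) 0.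
    by rewrite exprz_ge0 // ltW.
  by rewrite lattice_val_neg //; lia.
have [n_leN|n_gtN] := leP (l%:Z * i + k%:Z * j) N%:Z; first exact: IHN.
rewrite lattice_val_rec //; last by lia.
by rewrite addr_ge0 // IHN //; lia.
Qed.

Lemma rec_pred_eq0 (n : int) : ~ (complex.Im x = 0 /\ complex.Re x < 0) ->
  1 <= n -> p n = 0 -> p (n - l%:Z) = 0 /\ p (n - k%:Z) = 0.
Proof.
move=> x_nneg n_ge1 pn0.
have [i [j n_def]] := lattice_exists n coprime_kl.
suff : q i (j - 1) = 0 /\ q (i - 1) j = 0.
  move=> [/eqP + /eqP]; rewrite !lattice_val_eq0 // => /eqP pk0 /eqP pl0.
  by split; [rewrite -pl0|rewrite -pk0]; congr p; rewrite n_def; ring.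
have q_sum : q i (j - 1) + q (i - 1) j = 0.
  rewrite addrC -lattice_val_rec -?n_def //.
  by apply/eqP; rewrite lattice_val_eq0 // -n_def pn0.
have [im_x0|im_x_neq0] := eqVneq (complex.Im x) 0.
  have x_gt0 : 0 < x.
    have x_neq0 : x != 0 by rewrite mulf_neq0 ?invr_eq0 ?expf_neq0.
    move: x_nneg x_neq0; rewrite ltcE eq_complex /= im_x0 eqxx andbT => x_nneg.
    rewrite lt_neqAle eq_sym => -> /=; rewrite leNgt.
    by apply/negP => re_lt0; apply: x_nneg.
  move/eqP: q_sum; rewrite paddr_eq0 ?lattice_val_ge0 //; try lia.
  by move=> /andP[/eqP-> /eqP->].
apply: (sector_add_eq0 im_x_neq0 _ q_sum).
(* Writing [x * q i (j - 1)] as a translate gives first coordinates [i - 1] and [i - k], within the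
   bounds for the window ending at [n - 1]. *)
have <- : q (i - k%:Z) (j - 1 + l%:Z) = x * q i (j - 1).
  have := @lattice_val_shift _ k l a b p a_neq0 b_neq0 i (j - 1) 1.
  by rewrite !mulr1 expr1z.
by apply: (@lattice_cross_ge0 (absz (n - 1))); lia.
Qed.

End NonVanishing.

(** * From values at a point to polynomials *)

(** A zero at [z] passes to both predecessors; by induction these vanish identically, and then so
    does [P n] by the recurrence. The descent cannot reach [P 0 = 1]. *)
Lemma root_imp_term_eq0 (R : realType) (k l : nat) (A B : {poly R[i]})
    (P : int -> {poly R[i]}) (z : R[i]) (n : nat) :
    coprime k l -> (0 < l < k)%N -> is_recurrence_seq k l A B P ->
    A.[z] != 0 -> B.[z] != 0 ->
    ~ (complex.Im ((- B.[z]) ^+ k / (- A.[z]) ^+ l) = 0 /\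
       complex.Re ((- B.[z]) ^+ k / (- A.[z]) ^+ l) < 0) ->
  root (P n) z -> P n = 0.
Proof.
move=> coprime_kl /andP[l_gt0 l_lt_k] [P_rec P_0 P_neg] a_neq0 b_neq0 x_nneg.
move=> /rootP.
have p_rec (m : int) : 1 <= m ->
    (P m).[z] = - B.[z] * (P (m - l%:Z)).[z] + - A.[z] * (P (m - k%:Z)).[z].
  move=> /P_rec; rewrite -addrA => /eqP; rewrite addr_eq0 => /eqP->.
  by rewrite !hornerE; ring.
have main (N : nat) (m : int) :
    1 - k%:Z <= m <= N%:Z -> (P m).[z] = 0 -> P m = 0.
  elim: N m => [|N IHN] m m_win.
    have [->|m_neq0] := eqVneq m 0.
      by rewrite P_0 hornerC => /eqP; rewrite oner_eq0.
    by rewrite P_neg //; lia.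
  have [m_leN|m_gtN] := leP m N%:Z; first by apply: IHN; lia.
  have m_ge1 : 1 <= m by lia.
  move=> pm0; have [] := @rec_pred_eq0 R k l (- A.[z]) (- B.[z])
    (fun m => (P m).[z]) _ _ _ _ _ _ _ _ m x_nneg m_ge1 pm0 => //.
  - by rewrite oppr_eq0.
  - by rewrite oppr_eq0.
  - by rewrite P_0 hornerC.
  - by move=> m' /P_neg->; rewrite horner0.
  move=> /IHN pl0 /IHN pk0; have := P_rec m m_ge1.
  by rewrite pl0 ?pk0 ?mulr0 ?addr0 //; lia.
by apply: (main n); lia.
Qed.

Theorem theorem1p4 (R : realType) (k l : nat) (A B : {poly R[i]})
    (P : int -> {poly R[i]}) (z0 : R[i])
    (coprime_kl : coprime k l) (l_gt1 : (1 < l)%N) (l_lt_k : (l < k)%N)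
    (A_neq0 : A != 0) (B_neq0 : B != 0)
    (deg_AB : (1 <= (size (A * B)%R).-1)%N)
    (recP : is_recurrence_seq k l A B P)
    (z0_zero : (family_zeros (nonzero_terms P) `\` zeros A) z0) :
  Gamma1 k l A B z0.
Proof.
have [[f [f_neq0 [n f_def]] f_root] a_neq0] := z0_zero.
have a0 : A.[z0] != 0 by apply/negP => /eqP ?; apply: a_neq0; apply/rootP.
have quotE : (- B.[z0]) ^+ k / (- A.[z0]) ^+ l =
    (-1) ^+ (k - l) * quot_pow k l A B z0.
  rewrite /quot_pow [(- B.[z0]) ^+ k]exprNn [(- A.[z0]) ^+ l]exprNn.
  have -> : (-1) ^+ k = (-1) ^+ (k - l) * (-1) ^+ l :> R[i].
    by rewrite -exprD subnK // ltnW.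
  have sl0 : (-1) ^+ l != 0 :> R[i] by rewrite signr_eq0.
  have al0 : A.[z0] ^+ l != 0 by rewrite expf_neq0.
  move: ((-1) ^+ l) (A.[z0] ^+ l) sl0 al0 => s al s0 al0.
  by field; rewrite s0 al0.
(* [Gamma] and the real-part condition use signs differing by [(-1) ^+ l], which does not affect
   being real. *)
have signE : (-1) ^+ k * quot_pow k l A B z0 =
    (-1) ^+ l * ((-1) ^+ (k - l) * quot_pow k l A B z0).
  by rewrite mulrA -exprD subnKC // ltnW.
have Im_sign (m : nat) (y : R[i]) : complex.Im y = 0 ->
    complex.Im ((-1) ^+ m * y) = 0.
  rewrite -signr_odd; case: odd; case: y => c d /= ->; rewrite ?mulr0 ?mul0r.
    by lra.
  by lra.
rewrite /Gamma1.
have [b0|b_neq0] := eqVneq B.[z0] 0.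
  have quot0 : quot_pow k l A B z0 = 0.
    by rewrite /quot_pow b0 expr0n gtn_eqF ?mul0r // (leq_ltn_trans _ l_lt_k).
  (* Here [z0] itself is a zero of [B] outside those of [A], so the strict branch is excluded. *)
  case: asboolP => [_|[]]; last by exists z0; split=> //; apply/rootP.
  by rewrite /= /Gamma /= quot0 !mulr0.
have [im0 re_lt0] : complex.Im ((-1) ^+ (k - l) * quot_pow k l A B z0) = 0 /\
    complex.Re ((-1) ^+ (k - l) * quot_pow k l A B z0) < 0.
  apply: contrapT; rewrite -quotE => x_nneg.
  move: f_neq0; rewrite f_def => /eqP; apply.
  apply: (root_imp_term_eq0 coprime_kl _ recP a0 b_neq0 x_nneg).
    by rewrite l_lt_k ltnW.
  by rewrite -f_def.
have inGamma : Gamma k l A B z0 by split=> //; rewrite signE Im_sign.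
by case: asboolP => _; split=> //; apply: ltW.
Qed.
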